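(* Let $k \geq 1$ be an integer. A subset $S \subseteq V(\Omega_{2k})$ is a determining set for $\Omega_{2k}$ if and only if $S$ contains at least one of $\mathbf{u}$, $\mathbf{u}+\mathbf{1}$ for every $\mathbf{u} \in V(\Omega_{2k})$. Consequently $\mathrm{Det}(\Omega_{2k}) = 2^{2k-1}$.
   Context: The orthogonality graph $\Omega_{2k}$ has vertex set $\mathbb{Z}_2^{2k}$, the set of bitstrings $\mathbf{u} = u_1u_2\cdots u_{2k}$ with $u_i\in\{0,1\}$, and two vertices are adjacent if and only if their bitstrings differ in exactly $k$ positions. Addition $\mathbf{u}+\mathbf{w}$ is bitwise modulo 2, and $\mathbf{1}$ denotes the all-ones bitstring. A set $S \subseteq V(G)$ is a determining set for a graph $G$ if the only automorphism of $G$ fixing every vertex of $S$ is the identity (equivalently, every automorphism is uniquely determined by its action on $S$). $\mathrm{Det}(G)$ is the minimum size of a determining set of $G$. *)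

(* Defs.v *)
From mathcomp Require Import all_boot all_order all_fingroup all_algebra.
Set Implicit Arguments.
Unset Strict Implicit.
Unset Printing Implicit Defensive.
Import GRing.Theory.
Local Open Scope ring_scope.

(* Finite simple graphs are given by their adjacency relation on a finType.   *)
Section Determining.
Variables (T : finType) (e : rel T).
Implicit Types (f : {perm T}) (S : {set T}).

Definition automorphism f : bool := [forall x, forall y, e (f x) (f y) == e x y].

Definition determining S : bool :=
  [forall f : {perm T},
    automorphism f ==> [forall x in S, f x == x] ==> (f == 1%g)].

Lemma determining_setT : determining [set: T].
Proof.
apply/forallP => f; apply/implyP => _; apply/implyP => /forall_inP fixf.
by apply/eqP/permP => x; rewrite perm1; apply/eqP/fixf.
Qed.

(* The default candidate [set: T] only serves to make the minimum total; it   *)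
(* is always determining.                                                     *)
Definition Det : nat := #|[arg min_(S < [set: T] | determining S) #|S| ]|.

Lemma Det_attained : exists2 S, determining S & #|S| = Det.
Proof.
rewrite /Det; case: arg_minnP => [|S detS _]; first exact: determining_setT.
by exists S.
Qed.

Lemma Det_min S : determining S -> (Det <= #|S|)%N.
Proof.
rewrite /Det; case: arg_minnP => [|S0 _ minS0]; first exact: determining_setT.
exact: minS0.
Qed.

End Determining.

Definition ones (k : nat) : 'rV['Z_2]_(2 * k) := const_mx 1.

Definition Omega (k : nat) : rel 'rV['Z_2]_(2 * k) :=
  fun u w => #|[set i | u 0 i != w 0 i]| == k.

Lemma Omega_sym (k : nat) : symmetric (@Omega k).
Proof.
by move=> u w; rewrite /Omega; under eq_finset => i do rewrite eq_sym.
Qed.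

Lemma Omega_irrefl (k : nat) : (0 < k)%N -> irreflexive (@Omega k).
Proof.
move=> k_gt0 u; apply/negbTE; rewrite /Omega.
by under eq_finset => i do rewrite eqxx; rewrite cards0 eq_sym -lt0n.
Qed.

(* Main.v *)
(* The vertices u and u + 1 have the same neighbours, and conversely, if u and
   w agree at a position j and differ at a position i, they do not: flipping u
   on i |: B or on j |: B, where B is a set of k - 1 other positions, gives two
   neighbours of u whose distances to w differ by 2.  So the classes of
   vertices with equal neighbourhoods are the pairs {u, u + 1}.  Swapping the
   two elements of a pair is an automorphism, so a determining set meets every
   pair; and automorphisms preserve the classes, so fixing one element of a
   pair fixes the other. *)
Require Import Defs.
From mathcomp Require Import all_boot all_order all_fingroup all_algebra.
Import GRing.Theory.
Local Open Scope ring_scope.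

Lemma Z2_addr1_eq (a b : 'Z_2) : (a + 1 == b) = (a != b).
Proof. by case: a b => [[|[|a]] ?] [[|[|b]] ?]. Qed.

Lemma exists_card_subset (T : finType) (A : {set T}) (n : nat) :
  (n <= #|A|)%N -> exists2 B : {set T}, B \subset A & #|B| = n.
Proof.
rewrite -bin_gt0 -cards_draws => /card_gt0P [B].
by rewrite inE => /andP [BA /eqP cB]; exists B.
Qed.

Definition flip {n : nat} (A : {set 'I_n}) (u : 'rV['Z_2]_n) : 'rV['Z_2]_n :=
  \row_t (if t \in A then u 0 t + 1 else u 0 t).

Section Orthogonality.
Variable k : nat.
Implicit Types (u w x : 'rV['Z_2]_(2 * k)) (S : {set 'rV['Z_2]_(2 * k)}).

Lemma addr_onesK : involutive (fun u => u + ones k).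
Proof.
move=> u; apply/rowP => i; rewrite !mxE.
by apply/eqP; rewrite !Z2_addr1_eq negbK.
Qed.

(** Adding [ones k] complements the set of differing positions, and among [2 * k] positions a set
    has [k] elements exactly when its complement does. *)
Lemma Omega_addr_ones u x : Omega (u + ones k) x = Omega u x.
Proof.
rewrite /Omega.
have -> : [set i | (u + ones k) 0 i != x 0 i] = ~: [set i | u 0 i != x 0 i].
  by apply/setP => i; rewrite !inE !mxE Z2_addr1_eq.
set A := [set i | _]; have E : (#|A| + #|~: A| = k + k)%N.
  by rewrite cardsC card_ord mul2n addnn.
by apply/eqP/eqP => cA; move: E; rewrite cA; [apply: addIn | apply: addnI].
Qed.

Lemma Omega_flip u w (A : {set 'I_(2 * k)}) :
  Omega (flip A u) w = (#|[set t | (t \in A) (+) (u 0 t != w 0 t)]| == k).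
Proof.
rewrite /Omega; congr (#|pred_of_set _| == k); apply/setP => t; rewrite !inE mxE.
by case: (t \in A); rewrite // Z2_addr1_eq.
Qed.

Lemma Omega_flip_self u (A : {set 'I_(2 * k)}) : Omega (flip A u) u = (#|A| == k).
Proof.
rewrite Omega_flip; congr (#|pred_of_set _| == k); apply/setP => t.
by rewrite inE eqxx addbF.
Qed.

Lemma Omega_twins u w : (0 < k)%N ->
  (forall x, Omega x u = Omega x w) -> w = u \/ w = u + ones k.
Proof.
move=> k_gt0 tw; pose D := [set t | u 0 t != w 0 t].
have [/setP D0|/set0Pn [i iD]] := eqVneq D set0.
  left; apply/rowP => t; apply/esym/eqP.
  by have := D0 t; rewrite !inE => /negbFE.
have [/setP DT|/eqP/setP nDT] := eqVneq D setT.
  right; apply/rowP => t; rewrite !mxE; apply/esym/eqP.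
  by have := DT t; rewrite !inE Z2_addr1_eq.
have [j jD] : exists j, j \notin D.
  apply/existsP; rewrite -negb_forall; apply/negP => /forallP DT.
  by case: nDT => t; rewrite DT inE.
have ij : j != i by apply: contraNneq jD => ->.
(* Outside [i] and [j] there remain [2 * k - 2] positions, at least [k.-1]; this size makes [i |: B]
   and [j |: B] have exactly [k] elements. *)
have [|B sB cB] := @exists_card_subset _ (~: [set i; j]) k.-1.
  have := cardsC [set i; j]; rewrite cards2 eq_sym ij card_ord => E.
  rewrite -(leq_add2l 2) E; case: (k) k_gt0 => // n _.
  by rewrite mul2n doubleS add2n !ltnS -addnn leq_addr.
have iB : i \notin B.
  by apply: contraL isT => /(subsetP sB); rewrite !inE eqxx.
have jB : j \notin B.
  by apply: contraL isT => /(subsetP sB); rewrite !inE eqxx orbT.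
have := tw (flip (i |: B) u); have := tw (flip (j |: B) u).
rewrite !Omega_flip_self !cardsU1 iB jB cB add1n prednK // eqxx !Omega_flip.
(* [C] is where [flip B u] differs from [w]. Flipping [j] as well creates a difference and flipping
   [i] removes one, so both [#|C| + 1] and [#|C| - 1] would equal [k]. *)
pose C := [set t | (t \in B) (+) (t \in D)].
have -> : [set t | (t \in j |: B) (+) (u 0 t != w 0 t)] = j |: C.
  apply/setP => t; rewrite !inE; case: eqVneq => //= ->.
  by move: jD; rewrite inE => ->.
have -> : [set t | (t \in i |: B) (+) (u 0 t != w 0 t)] = C :\ i.
  apply/setP => t; rewrite !inE; case: eqVneq => //= ->.
  by move: iD; rewrite inE => ->.
have iC : i \in C by rewrite inE iD (negbTE iB).
have jC : j \notin C by rewrite inE (negbTE jB) (negbTE jD).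
rewrite cardsU1 jC => /esym /eqP Cj /esym /eqP Ci.
move: Cj; rewrite (cardsD1 i C) iC Ci => /eqP.
by rewrite !add1n -[X in _ == X]addn0 -addn2 eqn_add2l.
Qed.

Lemma addr_ones_neq u : (0 < k)%N -> u + ones k != u.
Proof.
move=> k_gt0; have i : 'I_(2 * k) by exists 0%N; rewrite muln_gt0.
apply/eqP => /rowP /(_ i); rewrite !mxE => /eqP.
by rewrite Z2_addr1_eq eqxx.
Qed.

Lemma automorphism_tperm_ones u : automorphism (@Omega k) (tperm u (u + ones k)).
Proof.
have tw x y : Omega (tperm u (u + ones k) x) y = Omega x y.
  by case: tpermP => [->|->|//]; rewrite Omega_addr_ones.
apply/forallP => x; apply/forallP => y.
by rewrite tw Omega_sym tw Omega_sym.
Qed.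

Lemma determining_OmegaP S : (0 < k)%N ->
  determining (@Omega k) S <-> forall u, u \in S \/ u + ones k \in S.
Proof.
move=> k_gt0; split=> [/forallP detS u | cover].
  apply/orP/negPn; rewrite negb_or; apply/negP => /andP [uS u1S].
  have := detS (tperm u (u + ones k)); rewrite automorphism_tperm_ones /=.
  apply/negP; rewrite negb_imply; apply/andP; split.
    apply/forall_inP => x xS.
    by rewrite tpermD //; apply: contraTneq xS => <-.
  apply/eqP => /permP /(_ u); rewrite tpermL perm1.
  by apply/eqP/addr_ones_neq.
apply/forallP => f; apply/implyP => /forallP autf; apply/implyP => /forall_inP fS.
apply/eqP/permP => u; rewrite perm1.
case: (cover u) => [/fS/eqP//|/fS/eqP fu1].
have autfE x y : Omega (f x) (f y) = Omega x y.
  by have /forallP/(_ y)/eqP := autf x.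
(* As [f] fixes [u + ones k], a twin of [u], the vertex [f u] is a twin of [u + ones k]. It is thus
   [u + ones k], which injectivity of [f] excludes, or [u]. *)
have [|E|] := @Omega_twins (u + ones k) (f u) k_gt0; last by rewrite addr_onesK.
  move=> x; rewrite -(permKV f x) autfE -{1}fu1 autfE.
  by rewrite Omega_sym Omega_addr_ones Omega_sym.
have /perm_inj/eqP : f (u + ones k) = f u by rewrite fu1 E.
by rewrite (negbTE (addr_ones_neq _ _)).
Qed.

Lemma card_Z2_row : (0 < k)%N ->
  #|{: 'rV['Z_2]_(2 * k)}| = (2 ^ (2 * k - 1)).*2.
Proof.
move=> k_gt0; rewrite card_mx card_ord mul1n -mul2n -expnS.
by rewrite subn1 prednK // muln_gt0.
Qed.

Lemma card_addr_ones S : #|[set u + ones k | u in S]| = #|S|.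
Proof. by apply: card_imset; apply: inv_inj; apply: addr_onesK. Qed.

Lemma Det_Omega : (0 < k)%N -> Det (@Omega k) = (2 ^ (2 * k - 1))%N.
Proof.
move=> k_gt0; apply/eqP; rewrite eqn_leq; apply/andP; split.
  have i : 'I_(2 * k) by exists 0%N; rewrite muln_gt0.
  (* Fixing one bit selects exactly one vertex of each pair, hence half of all vertices. *)
  pose S := [set u : 'rV['Z_2]_(2 * k) | u 0 i == 0].
  have SC : [set u + ones k | u in S] = ~: S.
    apply/setP => u; rewrite -{1}[u]addr_onesK (mem_imset _ _ (inv_inj addr_onesK)).
    by rewrite !inE !mxE Z2_addr1_eq.
  have <- : #|S| = (2 ^ (2 * k - 1))%N.
    by apply: double_inj; rewrite -card_Z2_row // -(cardsC S) -SC card_addr_ones addnn.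
  apply/Det_min/determining_OmegaP => // u; apply/orP.
  by rewrite !inE !mxE Z2_addr1_eq orbN.
have [S /(determining_OmegaP S k_gt0) cover <-] := Det_attained (@Omega k).
(* Lower bound: [S] and its translate by [ones k] have equal size and together cover all
   vertices. *)
rewrite -leq_double -card_Z2_row // -[X in (_ <= X)%N]addnn -{2}(card_addr_ones S).
apply: leq_trans (leq_card_setU _ _); rewrite -cardsT; apply/subset_leq_card.
apply/subsetP => u _; rewrite inE; case: (cover u) => [-> //|u1S].
by apply/orP; right; apply/imsetP; exists (u + ones k); rewrite ?addr_onesK.
Qed.

End Orthogonality.

Theorem theorem2 (k : nat) (hk : (1 <= k)%N) :
  (forall S : {set 'rV['Z_2]_(2 * k)},
     determining (@Omega k) S <->
     (forall u : 'rV['Z_2]_(2 * k), u \in S \/ u + ones k \in S)) /\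
  Det (@Omega k) = (2 ^ (2 * k - 1))%N.
Proof. by split=> [S|]; [apply: determining_OmegaP | apply: Det_Omega]. Qed.
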